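(* There is no injective nilspace morphism from the nilspace $X_{5,1}$ to a $5$-step compact filtered abelian group.
   Context: $\mathbb{T}=\mathbb{R}/\mathbb{Z}$; for $a\in\mathbb{Z}/q\mathbb{Z}$, $\frac aq$ denotes the corresponding element of $\frac1q\mathbb{Z}/\mathbb{Z}\subset\mathbb{T}$. $\partial_hF(x)=F(x+h)-F(x)$ and $\omega\cdot\vec h=\sum_i\omega_ih_i$. *Nilspaces.* A nilspace is a set $X$ with sets $C^n(X)\subset X^{\{0,1\}^n}$ of ''$n$-cubes'' ($n\ge0$) such that: (i) if $c\in C^n(X)$ and $\phi:\{0,1\}^m\to\{0,1\}^n$ extends to an affine map $\mathbb{R}^m\to\mathbb{R}^n$ then $c\circ\phi\in C^m(X)$; (ii) $C^0(X)=X$; (iii) for $n\ge1$, any $c':\{0,1\}^n\setminus\{1^n\}\to X$ whose restriction to each $(n-1)$-face containing $0^n$ is in $C^{n-1}(X)$ extends to some $c\in C^n(X)$. A nilspace morphism is a map sending $n$-cubes to $n$-cubes for every $n\ge0$. *The nilspace $X_{5,1}$.* Let $X_2=\mathbb{F}_2^2$, with $C^n(X_2)$ the set of tuples $\big(x+\sum_i h_i\omega_i+\sum_{i<j}h_{ij}\omega_i\omega_j\big)_{\omega\in\{0,1\}^n}$ with $x,h_i,h_{ij}\in\mathbb{F}_2^2$. Superscripts $(1),(2)$ denote coordinates in $\mathbb{F}_2^2$. Define $\rho:C^6(X_2)\to\frac12\mathbb{Z}/\mathbb{Z}$ by $$\rho\Big(\big(x+\sum_{i=1}^6h_i\omega_i+\sum_{1\le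 i<j\le6}h_{ij}\omega_i\omega_j\big)_{\omega\in\{0,1\}^6}\Big)=\frac{\sum h^{(1)}_{ab}h^{(1)}_{cd}h^{(2)}_{ef}}2 \bmod 1,$$ the sum being over the $45$ pairs $(\{\{a,b\},\{c,d\}\},\{e,f\})$ where $\{1,\dots,6\}$ is partitioned into doubletons $\{a,b\},\{c,d\},\{e,f\}$ (with $h_{ij}=h_{ji}$). Identifying $\{0,1\}^n$ with $\mathbb{F}_2^n$, set $X_{5,1}=X_2\times\frac12\mathbb{Z}/\mathbb{Z}$ with $C^n(X_{5,1})$ the set of maps $(Q,S):\mathbb{F}_2^n\to X_2\times\frac12\mathbb{Z}/\mathbb{Z}$ such that $Q\in C^n(X_2)$ and $\partial_{h_1}\cdots\partial_{h_6}S(x)=\rho\big((Q(x+\omega\cdot\vec h))_{\omega\in\{0,1\}^6}\big)$ for all $x,h_1,\dots,h_6\in\mathbb{F}_2^n$. *Filtered abelian groups.* A compact filtered abelian group is a compact abelian group $G$ with closed subgroups $G=G_0\ge G_1\ge G_2\ge\cdots$; it is $5$-step if $G_i=\{0\}$ for $i>5$. It is regarded as a nilspace with $C^n(G)$ the set of tuples $\big(\sum_{\alpha\in\{0,1\}^n}h_\alpha\prod_{i:\alpha_i=1}\omega_i\big)_{\omega\in\{0,1\}^n}$ with $h_\alpha\in G_{|\alpha|}$, $|\alpha|=\sum_i\alpha_i$. *)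

(* Defs.v *)
From HB Require Import structures.
From mathcomp Require Import all_boot all_order all_algebra.
From mathcomp Require Import all_classical all_reals all_analysis.
From mathcomp Require Import zify ring.

Set Implicit Arguments.
Unset Strict Implicit.
Unset Printing Implicit Defensive.

Import GRing.Theory.

Local Open Scope classical_set_scope.
Local Open Scope ring_scope.

(* {0,1}^n, identified throughout with F_2^n *)
Notation vertex n := 'rV['F_2]_n.

(* The family of sets of n-cubes C^n(X), n >= 0. Morphisms of nilspaces depend
   on nothing else. *)
Definition cube_structure (X : Type) := forall n : nat, set (vertex n -> X).

Definition nilspace_morphism (X Y : Type)
    (CX : cube_structure X) (CY : cube_structure Y) (f : X -> Y) : Prop :=
  forall (n : nat) (c : vertex n -> X), CX n c -> CY n (f \o c).

Notation X2 := 'rV['F_2]_2.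

Definition coord1 (x : X2) : 'F_2 := x ord0 ord0.
Definition coord2 (x : X2) : 'F_2 := x ord0 ord_max.

(* Only the values H i j with i < j matter. *)
Definition quad_cube n (x : X2) (h : 'I_n -> X2) (H : 'I_n -> 'I_n -> X2) :
    vertex n -> X2 :=
  fun w => x + \sum_(i < n) w ord0 i *: h i
     + \sum_(i < n) \sum_(j < n | (i < j)%N)
         (w ord0 i * w ord0 j) *: H i j.

Definition X2_cubes : cube_structure X2 :=
  fun n => [set c | exists x h H, c = @quad_cube n x h H].

(* The group (1/2)Z/Z is represented by 'F_2, an element a standing for a/2
   mod 1. The order conditions on a, ..., f select exactly one labelling of
   each pair ({{a,b},{c,d}},{e,f}), so that the sum has 45 terms. *)
Definition rho_coef (H : 'I_6 -> 'I_6 -> X2) : 'F_2 :=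
  \sum_(a < 6) \sum_(b < 6) \sum_(c < 6) \sum_(d < 6) \sum_(e < 6)
    \sum_(f < 6 | uniq [:: a; b; c; d; e; f] &&
                  [&& (a < b)%N, (c < d)%N, (e < f)%N & (a < c)%N])
      coord1 (H a b) * coord1 (H c d) * coord2 (H e f).

(* The value is independent of the coefficients chosen to represent the cube,
   see [rho_quad_cube]; outside C^6(X_2) it is a junk value. *)
Definition rho (c : vertex 6 -> X2) : 'F_2 :=
  rho_coef (xget (fun _ _ => 0) [set H | exists x h, c = quad_cube x h H]).

Definition X51 : Type := (X2 * 'F_2)%type.

Definition deriv_dir (U V : zmodType) (h : U) (F : U -> V) : U -> V :=
  fun x => F (x + h) - F x.

(* \partial_{h_0} ... \partial_{h_{k-1}} F *)
Definition iter_deriv (U V : zmodType) k (h : 'I_k -> U) (F : U -> V) : U -> V :=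
  foldr (fun i G => deriv_dir (h i) G) F (enum 'I_k).

Definition X51_cubes : cube_structure X51 := fun n =>
  [set c : vertex n -> X51 | X2_cubes (fst \o c) /\
     forall (x : vertex n) (h : 'I_6 -> vertex n),
       iter_deriv h (snd \o c) x
       = rho (fun w : vertex 6 => (c (x + \sum_(i < 6) w ord0 i *: h i)).1)].

Record compact_filtered_group (G : topologicalZmodType) (F : nat -> set G) :
    Prop := CompactFilteredGroup {
  cfg_compact : compact [set: G];
  cfg_hausdorff : hausdorff_space G;
  cfg_start : F 0%N = [set: G];
  cfg_zero : forall i, F i 0;
  cfg_sub : forall i x y, F i x -> F i y -> F i (x - y);
  cfg_closed : forall i, closed (F i);
  cfg_decr : forall i, F i.+1 `<=` F i }.

Definition filtration_step (G : zmodType) (s : nat) (F : nat -> set G) : Prop :=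
  forall i, (s < i)%N -> F i = [set 0].

Definition weight n (a : vertex n) : nat := (\sum_(i < n) (a ord0 i : nat))%N.

Definition group_cubes (G : zmodType) (F : nat -> set G) : cube_structure G :=
  fun n => [set c | exists h : vertex n -> G,
    (forall a, F (weight a) (h a)) /\
    c = fun w : vertex n => \sum_(a : vertex n)
          h a *+ (\prod_(i < n | a ord0 i == 1%R) (w ord0 i : nat))%N].

Lemma quad_cube_inj n (x y : X2) (h k : 'I_n -> X2) (H K : 'I_n -> 'I_n -> X2) :
  quad_cube x h H = quad_cube y k K ->
  forall i j : 'I_n, (i < j)%N -> H i j = K i j.
Proof.
pose e (i : 'I_n) : vertex n := delta_mx ord0 i.
pose D (c : vertex n -> X2) i j : X2 :=
  c (e i + e j) - c (e i) - c (e j) + c 0.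
suff key z l M (i j : 'I_n) : (i < j)%N -> D (@quad_cube n z l M) i j = M i j.
  by move=> eqc i j ij; rewrite -(key x h H i j ij) eqc key.
move=> ij; rewrite /D /quad_cube.
set L := fun w : vertex n => \sum_(a < n) w ord0 a *: l a.
set B := fun w : vertex n => \sum_(a < n) \sum_(b < n | (a < b)%N)
  (w ord0 a * w ord0 b) *: M a b.
rewrite -![\sum_(a < n) _ *: l a]/(L _).
rewrite -![\sum_(a < n) \sum_(b < n | _) _]/(B _).
have -> : L (e i + e j) = L (e i) + L (e j).
  by rewrite /L -big_split; apply: eq_bigr => a _; rewrite mxE scalerDl.
have -> : L 0 = 0 by rewrite /L big1 // => a _; rewrite mxE scale0r.
have -> : B 0 = 0.
  by rewrite /B big1 // => a _; rewrite big1 // => b _; rewrite mxE mul0r scale0r.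
have -> : B (e i + e j) = B (e i) + B (e j) + M i j.
  transitivity (B (e i) + B (e j) +
    \sum_(a < n) \sum_(b < n | (a < b)%N)
      (((a == i) && (b == j))%:R : 'F_2) *: M a b).
    rewrite /B -!big_split; apply: eq_bigr => a _.
    rewrite -!big_split; apply: eq_bigr => b ab /=.
    rewrite -!scalerDl; congr (_ *: _); rewrite !mxE /=.
    have : ~~ ((a == j) && (b == i)).
      by apply/negP => /andP[/eqP aj /eqP bi]; move: ab ij; rewrite aj bi; lia.
    by case: (a == i); case: (a == j); case: (b == i); case: (b == j) => //= _;
      rewrite ?(mulr0n, mulr1n); apply/eqP.
  congr (_ + _); rewrite (bigD1 i) //= (bigD1 j) //= !eqxx scale1r.
  rewrite big1 ?addr0; last first.
    by move=> b /andP[_ /negbTE ->]; rewrite andbF scale0r.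
  rewrite big1 ?addr0 // => a /negbTE ai.
  by rewrite big1 // => b _; rewrite ai scale0r.
rewrite !addr0 !opprD !addrA.
by apply/rowP => q; rewrite !mxE; ring.
Qed.

Lemma rho_quad_cube x h H : rho (quad_cube x h H) = rho_coef H.
Proof.
rewrite /rho; set P := (X in xget _ X).
have /(xgetPex (fun _ _ => 0)) : exists K, P K by exists H, x, h.
move: (xget _ _) => K [y [k eqc]].
have HK := quad_cube_inj eqc.
rewrite /rho_coef; do 6 (apply: eq_bigr => ? ?).
by case/andP: (ltac:(eassumption)) => _ /and4P[ab cd ef _]; rewrite !HK.
Qed.

(* Main.v *)
(* Let Q = (w_0 w_1 + w_4 w_5, w_2 w_3 + w_4 w_5) on F_2^6 and let S be the
   indicator function of 0. Pulling Q back along w |-> x + w M turns rho(Q) into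
   a function of M that is additive in each row and, like the determinant, takes
   the value 1 or 0 on the matrices whose rows are basis vectors according to
   whether these are distinct or not; hence it is det M, which is also the sixth
   derivative of S along the rows of M, and (Q, S) is a 6-cube of X_{5,1}. A
   morphism f to a 5-step group has a vanishing alternating sum over this cube.
   The signed measure (-1)^{|w|} on F_2^6 is pushed forward to 0 by Q, so the
   alternating sum of f(Q(w), 0) vanishes too. The two sums differ only at w = 0,
   which gives f(0, 1) = f(0, 0). *)
Require Import Defs.
From mathcomp Require Import all_boot all_order all_algebra.
From mathcomp Require Import all_classical all_reals all_analysis.
From mathcomp Require Import ring perm.

Set Implicit Arguments.
Unset Strict Implicit.
Unset Printing Implicit Defensive.

Import GRing.Theory.

Local Open Scope ring_scope.

(** * Arithmetic in characteristic 2 and cancelling sums *)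

Lemma F2E (x : 'F_2) : x = (x != 0)%:R.
Proof. by case: x => [[|[|k]]] // hk; apply/val_inj. Qed.

Lemma F2_addrr (x : 'F_2) : x + x = 0.
Proof. by rewrite (F2E x); case: (x != 0); apply/val_inj. Qed.

Lemma F2_opp (x : 'F_2) : - x = x.
Proof. by apply/eqP; rewrite eq_sym -addr_eq0 F2_addrr. Qed.

Lemma F2_mulrr (x : 'F_2) : x * x = x.
Proof. by rewrite (F2E x); case: (x != 0); apply/val_inj. Qed.

Lemma F2_addb (b c : bool) : (b (+) c)%:R = b%:R + c%:R :> 'F_2.
Proof. by case: b; case: c; apply/val_inj. Qed.

Lemma F2_andb (b c : bool) : (b && c)%:R = b%:R * c%:R :> 'F_2.
Proof. by case: b; case: c; apply/val_inj. Qed.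

Lemma F2mx_addrr m n (A : 'M['F_2]_(m, n)) : A + A = 0.
Proof. by apply/matrixP => i j; rewrite !mxE F2_addrr. Qed.

(* [V] may have 2-torsion: the vanishing comes from the pairing [w, w + d] having
   no fixed point, not from the sum being equal to its opposite. *)
Lemma sum_shift0 (V : zmodType) n (d : vertex n) (P : pred (vertex n))
    (g : vertex n -> V) :
  d != 0 -> (forall w, P (w + d) = P w) ->
  (forall w, P w -> g (w + d) = - g w) ->
  \sum_(w | P w) g w = 0.
Proof.
move=> d0 Pd gd.
have [i di] : exists i, d ord0 i = 1.
  case/rV0Pn: d0 => i di; exists i.
  by rewrite (F2E (d ord0 i)) di.
have dK : involutive (fun w : vertex n => w + d).
  by move=> w; rewrite -addrA F2mx_addrr addr0.
(* Translation by [d] flips coordinate [i], so it exchanges the halves [w_i = 0] and [w_i = 1]. *)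
rewrite (bigID (fun w : vertex n => w ord0 i == 0)) /=.
rewrite [X in _ + X](reindex_inj (inv_inj dK)) /=.
rewrite [X in _ + X](eq_bigl (fun w => P w && (w ord0 i == 0))); last first.
  move=> w; rewrite Pd !mxE di; congr (_ && _).
  by rewrite (F2E (w ord0 i)); case: (w ord0 i != 0).
rewrite [X in _ + X](eq_bigr (fun w => - g w)) ?sumrN ?subrr //.
by move=> w /andP[Pw _]; exact: gd.
Qed.

(** * Iterated derivatives *)

(** In characteristic 2 a derivative is a sum of two translates, so each direction in [s] doubles
    the index set; [w] records which directions are taken. The list [s] is arbitrary so that the
    induction can peel off one direction. *)
Lemma foldr_deriv (U : zmodType) n (h : 'I_n -> U) (S : U -> 'F_2)
    (s : seq 'I_n) (x : U) (D := fun (w : vertex n) (i : 'I_n) =>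
      if w ord0 i == 0 then 0 else h i) :
  uniq s ->
  foldr (fun i => deriv_dir (h i)) S s x =
  \sum_(w : vertex n | [forall i, (i \notin s) ==> (w ord0 i == 0)])
    S (x + \sum_i D w i).
Proof.
elim: s x => [|i s IHs] x /=.
  move=> _; rewrite (big_pred1 0) => [|w].
    by rewrite /D big1 ?addr0 // => i _; rewrite mxE eqxx.
  apply/forallP/eqP => [w0|-> i]; last by rewrite mxE eqxx.
  by apply/rowP => i; rewrite mxE; apply/eqP/w0.
case/andP=> sNi us; rewrite /deriv_dir !IHs // F2_opp addrC.
rewrite [RHS](bigID (fun w : vertex n => w ord0 i == 0)) /=.
set e : vertex n := delta_mx ord0 i.
have eE j : e ord0 j = (j == i)%:R by rewrite mxE eqxx.
congr (_ + _).
  apply: eq_bigl => w; apply/forallP/andP => [ws|[/forallP ws wi] j].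
    split; last exact: (implyP (ws i)).
    by apply/forallP => j; rewrite inE negb_or; apply/implyP => /andP[_ /(implyP (ws j))].
  apply/implyP => js; case: (eqVneq j i) => [->//|ji].
  by apply: (implyP (ws j)); rewrite inE negb_or ji.
have eK : involutive (fun w : vertex n => w + e).
  by move=> w; rewrite -addrA F2mx_addrr addr0.
(* The vectors with [w_i = 1] are those with [w_i = 0] translated by [e], which brings in the
   summand [h i]. *)
rewrite [RHS](reindex_inj (inv_inj eK)) /=.
apply: eq_big => [w|w ws].
  apply/forallP/andP => [ws|[/forallP ws wi] j].
    have /eqP wi := implyP (ws i) sNi.
    split; last by rewrite mxE wi eE eqxx.
    apply/forallP => j; rewrite inE negb_or mxE eE; apply/implyP => /andP[ji js].
    by rewrite (negPf ji) addr0; apply: (implyP (ws j)).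
  apply/implyP => js; case: (eqVneq j i) wi => [->|ji _].
    by rewrite mxE eE eqxx (F2E (w ord0 i)); case: (w ord0 i != 0).
  have := implyP (ws j); rewrite inE negb_or ji mxE eE (negPf ji) addr0; exact.
have wi : w ord0 i = 0 by apply/eqP; exact: (implyP (forallP ws i)).
congr S; rewrite -addrA; congr (_ + _).
rewrite (bigD1 i) //= [RHS](bigD1 i) //= /D wi mxE wi eE !eqxx add0r add0r.
congr (_ + _); apply: eq_bigr => j ji.
by rewrite mxE eE (negPf ji) addr0.
Qed.

Lemma iter_deriv_vertex m n (h : 'I_n -> vertex m) (S : vertex m -> 'F_2) x :
  iter_deriv h S x = \sum_(w : vertex n) S (x + \sum_i w ord0 i *: h i).
Proof.
rewrite /iter_deriv foldr_deriv ?enum_uniq //.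
apply: eq_big => [w|w _]; first by apply/forallP => i; rewrite mem_enum.
congr (S (_ + _)); apply: eq_bigr => i _.
by rewrite [in RHS](F2E (w ord0 i)); case: eqP; rewrite ?scale0r ?scale1r.
Qed.

(** The derivative counts mod 2 the solutions [w] of [x + w *m M = z]: there is exactly one if [M]
    is invertible, and otherwise a kernel vector pairs them off. *)
Lemma iter_deriv_indicator n (h : 'I_n -> vertex n) (z x : vertex n) :
  iter_deriv h (fun w => (w == z)%:R) x = \det (\matrix_i h i).
Proof.
set M := \matrix_i h i.
have hM (w : vertex n) : \sum_i w ord0 i *: h i = w *m M.
  by rewrite mulmx_sum_row; apply: eq_bigr => i _; rewrite rowK.
rewrite iter_deriv_vertex; under eq_bigr do rewrite hM.
case: (boolP (\det M == 0)) => [detM0|detM1].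
  rewrite (eqP detM0); have /det0P[v v0 vM] := detM0.
  apply: (sum_shift0 v0) => // w _.
  by rewrite mulmxDl vM addr0 F2_opp.
have uM : M \in unitmx by rewrite unitmxE unitfE.
rewrite (F2E (\det M)) detM1 (bigD1 ((z - x) *m invmx M)) //= mulmxKV //.
rewrite [x + _]addrC subrK eqxx big1 ?addr0 // => w wz.
case: eqP => // zw; case/eqP: wz.
by rewrite -zw addrC addKr mulmxK.
Qed.

(** * Quadratic cubes and pullbacks of monomials *)

(** The polarization of the monomial [x_p x_q] at rows [i] and [j]; over F_2 it is the 2 x 2
    minor. *)
Definition minor2 (R : comPzRingType) m n (M : 'M[R]_(m, n)) (p q : 'I_n)
    (i j : 'I_m) : R :=
  M i p * M j q + M j p * M i q.

Lemma quad_cubeD n x y h k H K (w : vertex n) :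
  quad_cube x h H w + quad_cube y k K w =
  quad_cube (x + y) (fun i => h i + k i) (fun i j => H i j + K i j) w.
Proof.
rewrite /quad_cube; under [in RHS]eq_bigr do rewrite scalerDr.
under [X in _ = _ + X]eq_bigr do (under eq_bigr do rewrite scalerDr; rewrite big_split).
by rewrite !big_split /= addrACA; congr (_ + _); rewrite addrACA.
Qed.

Lemma sum_square (V : zmodType) n (F : 'I_n -> 'I_n -> V) :
  \sum_i \sum_j F i j =
  \sum_i F i i + \sum_(i < n) \sum_(j < n | (i < j)%N) (F i j + F j i).
Proof.
have -> : \sum_i \sum_j F i j = \sum_(i < n) (\sum_(j < n | (i < j)%N) F i j +
   (F i i + \sum_(j < n | (j < i)%N) F i j)).
  apply: eq_bigr => i _; rewrite (bigD1 i) //= (bigID (fun j : 'I_n => (i < j)%N)) /=.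
  rewrite addrCA; congr (_ + (_ + _)); apply: eq_bigl => j.
    by case: eqVneq => [->|//]; rewrite ltnn.
  by rewrite -leqNgt ltn_neqAle.
rewrite big_split big_split /= addrCA; congr (_ + _).
under [RHS]eq_bigr do rewrite big_split.
rewrite big_split /=; congr (_ + _).
under eq_bigr do rewrite big_mkcond; under [RHS]eq_bigr do rewrite big_mkcond.
by rewrite exchange_big.
Qed.

Lemma quad_cube_monomial m n (p q : 'I_n) (e : X2) (x : vertex n)
    (h : 'I_m -> vertex n) (M := \matrix_i h i)
    (u := fun w : vertex m => x + \sum_i w ord0 i *: h i) :
  exists l, forall w : vertex m, (u w ord0 p * u w ord0 q) *: e =
    quad_cube ((x ord0 p * x ord0 q) *: e) l (fun i j => minor2 M p q i j *: e) w.
Proof.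
(* The first two terms are the cross terms with [x]; the third comes from the diagonal, where
   [w_i * w_i = w_i]. *)
exists (fun i => (x ord0 p * M i q + x ord0 q * M i p + M i p * M i q) *: e) => w.
have uE r : u w ord0 r = x ord0 r + \sum_i w ord0 i * M i r.
  by rewrite /u !mxE summxE; congr (_ + _); apply: eq_bigr => i _; rewrite !mxE.
rewrite /quad_cube.
under eq_bigr do rewrite scalerA.
under [X in _ = _ + X]eq_bigr do (under eq_bigr do rewrite scalerA; rewrite -scaler_suml).
rewrite -!scaler_suml -!scalerDl; congr (_ *: _).
have SE : (\sum_i w ord0 i * M i p) * (\sum_i w ord0 i * M i q) =
    \sum_i w ord0 i * (M i p * M i q) +
    \sum_(i < m) \sum_(j < m | (i < j)%N) w ord0 i * w ord0 j * minor2 M p q i j.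
  rewrite mulr_suml; under eq_bigr do rewrite mulr_sumr.
  rewrite sum_square; congr (_ + _).
    by apply: eq_bigr => i _; rewrite mulrACA F2_mulrr.
  by apply: eq_bigr => i _; apply: eq_bigr => j _; rewrite /minor2; ring.
rewrite !uE mulrDl !mulrDr SE mulr_sumr mulr_suml -addrA !addrA; congr (_ + _).
rewrite -!addrA; congr (_ + _); rewrite -!big_split /=.
by apply: eq_bigr => i _; ring.
Qed.

(** * Multilinear functions of the rows and the determinant *)

(** Over F_2 additivity is linearity; the hypotheses are those of [determinant_multilinear] with
    both scalars 1. *)
Definition row_additive n (Phi : 'M['F_2]_n -> 'F_2) : Prop :=
  forall k M M1 M2, row k M = row k M1 + row k M2 ->
    row' k M1 = row' k M -> row' k M2 = row' k M ->
    Phi M = Phi M1 + Phi M2.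

Lemma row_additive_det n : row_additive (@determinant 'F_2 n).
Proof.
move=> k M M1 M2 Mk M1k M2k.
by rewrite (@determinant_multilinear _ _ M M1 M2 k 1 1) ?mul1r ?scale1r.
Qed.

(** Induction on the number [m] of leading rows that may fail to be basis vectors: the difference of
    the two functions is additive in the last of these rows, so basis vectors suffice there. *)
Lemma row_additive_ext n (Phi Psi : 'M['F_2]_n -> 'F_2) :
  row_additive Phi -> row_additive Psi ->
  (forall g : 'I_n -> 'I_n, Phi (\matrix_i delta_mx 0 (g i)) =
                           Psi (\matrix_i delta_mx 0 (g i))) ->
  Phi =1 Psi.
Proof.
move=> addPhi addPsi basis M.
have : exists2 m, (m <= n)%N &
    forall i : 'I_n, (m <= i)%N -> exists j, row i M = delta_mx 0 j.
  by exists n => // i; rewrite leqNgt ltn_ord.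
case=> m; elim: m M => [|m IHm] M lemn Mbasis.
  have /fin_all_exists[g gE] := fun i => Mbasis i (leq0n i).
  have -> : M = \matrix_i delta_mx 0 (g i); last exact: basis.
  by apply/row_matrixP => i; rewrite rowK gE.
pose k := Ordinal lemn.
pose N v : 'M['F_2]_n := \matrix_i (if i == k then v else row i M).
have rowN v : row k (N v) = v by rewrite rowK eqxx.
have row'N u v : row' k (N u) = row' k (N v).
  by apply/matrixP => i j; rewrite !mxE eq_sym (negPf (neq_lift _ _)).
pose D v := Phi (N v) - Psi (N v).
have DD : {morph D : u v / u + v}.
  move=> u v; have Nuv : row k (N (u + v)) = row k (N u) + row k (N v).
    by rewrite !rowN.
  rewrite /D (addPhi k _ _ _ Nuv (row'N _ _) (row'N _ _)).
  by rewrite (addPsi k _ _ _ Nuv (row'N _ _) (row'N _ _)) addrACA -opprD.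
have D0 : D 0 = 0 by apply: (addrI (D 0)); rewrite -DD !addr0.
have MN : M = N (row k M).
  by apply/row_matrixP => i; rewrite rowK; case: eqP => // ->.
apply/eqP; rewrite -subr_eq0 MN -/(D _) [row k M]row_sum_delta (big_morph _ DD D0).
apply/eqP/big1 => j _; rewrite (F2E (row _ _ _ _)); case: (_ != 0); last by rewrite scale0r.
rewrite scale1r; apply/eqP; rewrite subr_eq0; apply/eqP/IHm => [|i]; first exact: ltnW.
rewrite leq_eqVlt => /predU1P[mi|mi].
  by exists j; rewrite rowK (_ : i == k) //; apply/eqP/val_inj.
have [l li] := Mbasis i mi; exists l; rewrite rowK (_ : i == k = false) //.
by apply/eqP => ik; rewrite ik ltnn in mi.
Qed.

Lemma det_basis_rows n (g : 'I_n -> 'I_n) :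
  \det (\matrix_i delta_mx 0 (g i)) = (injectiveb g)%:R :> 'F_2.
Proof.
case: injectiveP => [injg|ninjg].
  rewrite (_ : \matrix_i _ = perm_mx (perm injg)) ?det_perm.
    by rewrite (_ : -1 = 1) ?expr1n //; apply/val_inj.
  by apply/matrixP => i j; rewrite !mxE eqxx permE /= eq_sym.
have /injectivePn[i [j ij gij]] : ~~ injectiveb g by apply/injectiveP.
by apply: (determinant_alternate ij) => l; rewrite !mxE gij.
Qed.

(** * Row additivity of the pulled back rho *)

Local Notation e1 := (delta_mx 0 0 : X2).
Local Notation e2 := (delta_mx 0 ord_max : X2).

(* The coefficients [h_{ij}] of the pullback of [Qmap] (below) along the affine
   map with linear part [M], see [Qmap_affine]. *)
Definition Qcoef n (M : 'M['F_2]_(n, 6)) (i j : 'I_n) : X2 :=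
  minor2 M (inord 0) (inord 1) i j *: e1 + minor2 M (inord 2) (inord 3) i j *: e2
  + minor2 M (inord 4) (inord 5) i j *: (e1 + e2).

Lemma coord1_Qcoef n (M : 'M['F_2]_(n, 6)) i j :
  coord1 (Qcoef M i j) =
  minor2 M (inord 0) (inord 1) i j + minor2 M (inord 4) (inord 5) i j.
Proof. by rewrite /coord1 !mxE /= !(mulr0, mulr1, addr0). Qed.

Lemma coord2_Qcoef n (M : 'M['F_2]_(n, 6)) i j :
  coord2 (Qcoef M i j) =
  minor2 M (inord 2) (inord 3) i j + minor2 M (inord 4) (inord 5) i j.
Proof. by rewrite /coord2 !mxE /= !(mulr0, mulr1, add0r). Qed.

Lemma minor2_linear m n (M M1 M2 : 'M['F_2]_(m, n)) (k : 'I_m) p q i j :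
  row k M = row k M1 + row k M2 -> row' k M1 = row' k M ->
  row' k M2 = row' k M -> i != j ->
  if (k == i) || (k == j) then minor2 M p q i j = minor2 M1 p q i j + minor2 M2 p q i j
  else minor2 M1 p q i j = minor2 M p q i j /\ minor2 M2 p q i j = minor2 M p q i j.
Proof.
move=> Mk M1k M2k ij.
have Ek r : M k r = M1 k r + M2 k r by move/rowP/(_ r): Mk; rewrite !mxE.
have E1 l r : l != k -> M1 l r = M l r.
  rewrite eq_sym => kl; have [l' ->] := unlift_some kl.
  by move/matrixP/(_ l' r): M1k; rewrite !mxE.
have E2 l r : l != k -> M2 l r = M l r.
  rewrite eq_sym => kl; have [l' ->] := unlift_some kl.
  by move/matrixP/(_ l' r): M2k; rewrite !mxE.
rewrite /minor2 ![k == _]eq_sym; have [ik|ik] /= := eqVneq i k.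
  have jk : j != k by rewrite -ik eq_sym.
  by rewrite ik !Ek !(E1 j) ?(E2 j) //; ring.
have [->|jk] := eqVneq j k; last by rewrite !E1 ?E2.
by rewrite !Ek !(E1 i) ?(E2 i) //; ring.
Qed.

(** The indices of each summand exhaust ['I_6], so [k] lies in exactly one of the three pairs: one
    factor splits and the other two do not change. *)
Lemma rho_coef_additive (k : 'I_6) (H H1 H2 : 'I_6 -> 'I_6 -> X2) :
  (forall i j, i != j ->
    if (k == i) || (k == j) then H i j = H1 i j + H2 i j
    else H1 i j = H i j /\ H2 i j = H i j) ->
  rho_coef H = rho_coef H1 + rho_coef H2.
Proof.
move=> lin; rewrite /rho_coef.
rewrite -big_split; apply: eq_bigr => a _.
rewrite -big_split; apply: eq_bigr => b _.
rewrite -big_split; apply: eq_bigr => c _.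
rewrite -big_split; apply: eq_bigr => d _.
rewrite -big_split; apply: eq_bigr => e _.
rewrite -big_split; apply: eq_bigr => f /andP[u6 _] /=.
have ks : k \in [:: a; b; c; d; e; f].
  apply: contraT => kNs; have uks : uniq [:: k; a; b; c; d; e; f].
    by rewrite cons_uniq kNs.
  by have := max_card (mem [:: k; a; b; c; d; e; f]); rewrite card_ord (card_uniqP uks).
have [ab cd ef] : [/\ a != b, c != d & e != f].
  by move: u6; rewrite /= !inE !negb_or => /and5P[/andP[-> _] _ /andP[-> _] _ /andP[-> _]].
move: (lin _ _ ab) (lin _ _ cd) (lin _ _ ef); rewrite /coord1 /coord2.
(* Since [k] occurs exactly once in the list, only six of the 64 combinations of comparisons
   survive. *)
have := count_uniq_mem k u6; rewrite ks /= ![_ == k]eq_sym.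
case: (k == a); case: (k == b); case: (k == c); case: (k == d);
  case: (k == e); case: (k == f) => //= _.
- by move=> -> [-> ->] [-> ->]; rewrite !mxE; ring.
- by move=> -> [-> ->] [-> ->]; rewrite !mxE; ring.
- by move=> [-> ->] -> [-> ->]; rewrite !mxE; ring.
- by move=> [-> ->] -> [-> ->]; rewrite !mxE; ring.
- by move=> [-> ->] [-> ->] ->; rewrite !mxE; ring.
- by move=> [-> ->] [-> ->] ->; rewrite !mxE; ring.
Qed.

Lemma scaler3D (R : pzRingType) (V : lmodType R) (a b c a' b' c' : R)
    (u v w : V) :
  (a + a') *: u + (b + b') *: v + (c + c') *: w =
  a *: u + b *: v + c *: w + (a' *: u + b' *: v + c' *: w).
Proof. by rewrite !scalerDl (addrACA (a *: u)) (addrACA (a *: u + b *: v)). Qed.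

Lemma row_additive_rho : row_additive (fun M : 'M['F_2]_6 => rho_coef (Qcoef M)).
Proof.
move=> k M M1 M2 Mk M1k M2k; apply: (rho_coef_additive (k := k)) => i j ij.
have lin p q := minor2_linear p q Mk M1k M2k ij.
move: (lin (inord 0) (inord 1)) (lin (inord 2) (inord 3)) (lin (inord 4) (inord 5)).
rewrite /Qcoef; case: ifP => _; last by do 3 case=> -> ->.
by do 3 move=> ->; exact: scaler3D.
Qed.

(** * Evaluation of rho on basis rows *)

(** Plain naturals, nested like the sums of [rho_coef], so that its 45 terms can be enumerated by
    computation. *)
Definition sextuples : seq (nat * nat * nat * nat * nat * nat) :=
  [seq (p, f) | p <- [seq (p, e) | p <- [seq (p, d) | p <- [seq (p, c) | p <-
    [seq (a, b) | a <- iota 0 6, b <- iota 0 6],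
    c <- iota 0 6], d <- iota 0 6], e <- iota 0 6], f <- iota 0 6].

Definition matchings := [seq t <- sextuples |
  let: (a, b, c, d, e, f) := t in
  uniq [:: a; b; c; d; e; f] && [&& (a < b)%N, (c < d)%N, (e < f)%N & (a < c)%N]].

Lemma rho_coef_matchings (A B : nat -> nat -> 'F_2) (H : 'I_6 -> 'I_6 -> X2) :
  (forall i j : 'I_6, coord1 (H i j) = A i j) ->
  (forall i j : 'I_6, coord2 (H i j) = B i j) ->
  rho_coef H = \sum_(t <- matchings)
    let: (a, b, c, d, e, f) := t in A a b * A c d * B e f.
Proof.
move=> HA HB; rewrite big_filter big_mkcond !big_allpairs /rho_coef.
have ord_iota n (G : nat -> 'F_2) : \sum_(a < n) G a = \sum_(a <- iota 0 n) G a.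
  by rewrite -(big_mkord xpredT) /index_iota subn0.
rewrite -(ord_iota 6); apply: eq_bigr => a _.
rewrite -(ord_iota 6); apply: eq_bigr => b _.
rewrite -(ord_iota 6); apply: eq_bigr => c _.
rewrite -(ord_iota 6); apply: eq_bigr => d _.
rewrite -(ord_iota 6); apply: eq_bigr => e _.
rewrite -(ord_iota 6) big_mkcond; apply: eq_bigr => f _.
by rewrite !HA HB.
Qed.

(* The polarizations of w_0 w_1 + w_4 w_5 and w_2 w_3 + w_4 w_5 on pairs of basis
   vectors. *)
Definition polar1 (p q : nat) : bool :=
  match p, q with 0, 1 | 1, 0 | 4, 5 | 5, 4 => true | _, _ => false end%N.

Definition polar2 (p q : nat) : bool :=
  match p, q with 2, 3 | 3, 2 | 4, 5 | 5, 4 => true | _, _ => false end%N.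

(** A Boolean model of [rho_coef (Qcoef M)] when the rows of [M] are the basis vectors indexed by
    [s]: exclusive or is addition in F_2, conjunction is multiplication. *)
Definition rho_basis (s : seq nat) : bool :=
  let g := nth 0%N s in
  foldr (fun t x => (let: (a, b, c, d, e, f) := t in
    [&& polar1 (g a) (g b), polar1 (g c) (g d) & polar2 (g e) (g f)]) (+) x)
  false matchings.

(** Exhaustive evaluation over the 6^6 choices of basis rows. *)
Lemma rho_basis_uniq :
  let all6 P := all P (iota 0 6) in
  all6 (fun a => all6 (fun b => all6 (fun c => all6 (fun d => all6 (fun e =>
    all6 (fun f => let s := [:: a; b; c; d; e; f] in rho_basis s == uniq s)))))).
Proof. by vm_compute. Qed.

Lemma rho_basis_rows (g : 'I_6 -> 'I_6) :
  rho_coef (Qcoef (\matrix_i delta_mx 0 (g i))) = (injectiveb g)%:R.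
Proof.
pose s := map val (codom g).
have sE (i : 'I_6) : nth 0%N s i = g i.
  by rewrite /s codomE -map_comp (nth_map i) ?size_enum_ord ?nth_ord_enum.
have inordE k (i : 'I_6) : (k < 6)%N -> (inord k == i :> 'I_6) = (k == i :> nat).
  by move=> k6; rewrite -val_eqE /= inordK.
rewrite (rho_coef_matchings (A := fun a b => (polar1 (nth 0%N s a) (nth 0%N s b))%:R)
  (B := fun a b => (polar2 (nth 0%N s a) (nth 0%N s b))%:R)); last first.
- move=> i j; rewrite coord2_Qcoef /minor2 !mxE !eqxx /= !inordE // !sE.
  by case: (g i) (g j) => [[|[|[|[|[|[|?]]]]]] ?] [[|[|[|[|[|[|?]]]]]] ?] //; apply/val_inj.
- move=> i j; rewrite coord1_Qcoef /minor2 !mxE !eqxx /= !inordE // !sE.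
  by case: (g i) (g j) => [[|[|[|[|[|[|?]]]]]] ?] [[|[|[|[|[|[|?]]]]]] ?] //; apply/val_inj.
have -> : injectiveb g = uniq s by rewrite map_inj_uniq //; exact: val_inj.
have <- : rho_basis s = uniq s.
  have : size s = 6 by rewrite size_map size_codom card_ord.
  have : all (mem (iota 0 6)) s.
    by apply/allP => _ /mapP[i _ ->]; rewrite inE mem_iota ltn_ord.
  case: (s) => [|a [|b [|c [|d [|e [|f [|]]]]]]] // /and5P[a6 b6 c6 d6 /and3P[e6 f6 _]] _.
  move: rho_basis_uniq => /allP/(_ _ a6)/allP/(_ _ b6)/allP/(_ _ c6).
  by move=> /allP/(_ _ d6)/allP/(_ _ e6)/allP/(_ _ f6)/eqP.
rewrite /rho_basis; elim: matchings => [|[[[[[a b] c] d] e] f] l IHl].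
  by rewrite big_nil.
by rewrite big_cons IHl /= F2_addb !F2_andb mulrA.
Qed.

Lemma rho_det (M : 'M['F_2]_6) : rho_coef (Qcoef M) = \det M.
Proof.
apply: (row_additive_ext row_additive_rho (@row_additive_det 6)) => g.
by rewrite rho_basis_rows det_basis_rows.
Qed.

(** * The 6-cube (Q, S) *)

Definition Qmap (w : vertex 6) : X2 :=
  (w 0 (inord 0) * w 0 (inord 1)) *: e1 + (w 0 (inord 2) * w 0 (inord 3)) *: e2
  + (w 0 (inord 4) * w 0 (inord 5)) *: (e1 + e2).

Lemma Qmap_affine n (x : vertex 6) (h : 'I_n -> vertex 6) :
  exists y l, (fun w : vertex n => Qmap (x + \sum_i w ord0 i *: h i)) =
    quad_cube y l (Qcoef (\matrix_i h i)).
Proof.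
have [l1 E1] := quad_cube_monomial (inord 0) (inord 1) e1 x h.
have [l2 E2] := quad_cube_monomial (inord 2) (inord 3) e2 x h.
have [l3 E3] := quad_cube_monomial (inord 4) (inord 5) (e1 + e2) x h.
do 2 eexists; apply: funext => w.
by rewrite /Qmap E1 E2 E3 !quad_cubeD.
Qed.

Definition delta_cube (w : vertex 6) : X51 := (Qmap w, (w == 0)%:R).

Lemma delta_cubeP : X51_cubes delta_cube.
Proof.
split.
  (* The identity parametrization, with base point 0 and the basis vectors as directions, exhibits
     [Qmap] itself as a cube. *)
  have [y [l Ql]] := Qmap_affine 0 (fun i : 'I_6 => delta_mx 0 i).
  exists y, l, (Qcoef (\matrix_i delta_mx 0 i)); rewrite -Ql.
  by apply: funext => w; rewrite add0r -row_sum_delta.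
move=> x h; rewrite [LHS](iter_deriv_indicator h 0 x).
have [y [l /= ->]] := Qmap_affine x h.
by rewrite rho_quad_cube rho_det.
Qed.

(** * Alternating sums *)

Definition parity n (w : vertex n) : 'F_2 := \sum_i w ord0 i.

Lemma parityD n (w d : vertex n) : parity (w + d) = parity w + parity d.
Proof. by rewrite /parity -big_split; apply: eq_bigr => i _; rewrite mxE. Qed.

Definition altsum (V : zmodType) n (P : pred (vertex n)) (g : vertex n -> V) : V :=
  \sum_(w | P w) (if parity w == 0 then g w else - g w).

(** An odd translation reverses the sign, so the terms at [w] and [w + d] cancel. *)
Lemma altsum_shift0 (V : zmodType) n (d : vertex n) (P : pred (vertex n))
    (g : vertex n -> V) :
  parity d = 1 -> (forall w, P (w + d) = P w) ->
  (forall w, P w -> g (w + d) = g w) -> altsum P g = 0.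
Proof.
move=> d1 Pd gd; apply: (@sum_shift0 _ _ d) => // [|w Pw].
  apply/eqP => d0; move: d1; rewrite d0 /parity big1 // => i _.
  by rewrite mxE.
rewrite gd // parityD d1 (F2E (parity w)).
by case: (parity w != 0); rewrite //= opprK.
Qed.

(** The coefficient of the full monomial lies in [F n], hence vanishes; every other monomial omits
    some coordinate [i], and flipping [w_i] changes only the sign. *)
Lemma altsum_group_cube (G : zmodType) (F : nat -> set G) n (c : vertex n -> G) :
  F n = [set 0]%classic -> group_cubes F c -> altsum xpredT c = 0.
Proof.
move=> Fn [h [Fh ->]].
pose m a (w : vertex n) :=
  h a *+ (\prod_(i < n | a ord0 i == 1%R) (w ord0 i : nat))%N.
have -> : altsum xpredT (fun w => \sum_a m a w) =
    \sum_a altsum xpredT (m a).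
  rewrite /altsum exchange_big /=; apply: eq_bigr => w _.
  by case: ifP => // _; rewrite sumrN.
apply: big1 => a _; case: (boolP [forall i, a ord0 i == 1]) => [/forallP a1|].
  have wa : weight a = n.
    rewrite /weight (eq_bigr (fun=> 1%N)) ?sum1_card ?card_ord // => i _.
    by rewrite (eqP (a1 i)).
  have := Fh a; rewrite wa Fn => /= ha0.
  by rewrite /altsum big1 // => w _; rewrite /m ha0 mul0rn oppr0 if_same.
case/forallPn => i ai; apply: (@altsum_shift0 _ _ (delta_mx 0 i)) => // [|w _].
  rewrite /parity (bigD1 i) //= mxE !eqxx big1 ?addr0 // => j /negPf ji.
  by rewrite mxE eqxx ji.
rewrite /m; congr (_ *+ _); apply: eq_bigr => j /eqP aj.
suff -> : (w + delta_mx 0 i) ord0 j = w ord0 j by [].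
have ji : j != i by apply/eqP => ji; rewrite -ji aj eqxx in ai.
by rewrite !mxE eqxx (negPf ji) addr0.
Qed.

Lemma altsumID (V : zmodType) n (P Q : pred (vertex n)) (g : vertex n -> V) :
  altsum (fun w => P w && ~~ Q w) g = 0 ->
  altsum P g = altsum (fun w => P w && Q w) g.
Proof. by rewrite /altsum => PQ0; rewrite (bigID Q) /= PQ0 addr0. Qed.

Lemma altsum_Qmap (V : zmodType) (phi : X2 -> V) :
  altsum xpredT (phi \o Qmap) = 0.
Proof.
pose d k : vertex 6 := delta_mx 0 (inord k).
have dE k l : (k < 6)%N -> (l < 6)%N -> d k 0 (inord l) = (k == l)%:R.
  by move=> k6 l6; rewrite mxE eqxx /= -val_eqE /= !inordK // eq_sym.
have parity_d k : parity (d k) = 1.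
  rewrite /parity (bigD1 (inord k)) //= mxE !eqxx big1 ?addr0 // => j /negPf jk.
  by rewrite mxE eqxx jk.
clearbody d.
(* Flipping w_1 cancels the part of the sum with w_0 = 0, and likewise w_3 with
   w_2 = 0 and w_5 with w_4 = 0; on the rest, flipping all three preserves [Qmap]. *)
pose P k (w : vertex 6) := w 0 (inord k) == 1.
have P0 k w : ~~ P k w -> w 0 (inord k) = 0.
  by rewrite /P (F2E (w _ _)); case: (_ != 0).
rewrite (@altsumID _ _ _ (P 0%N)); last first.
  apply: (@altsum_shift0 _ _ (d 1%N)) => // w.
    by rewrite /P mxE dE // addr0.
  move/P0 => w0; congr phi.
  by rewrite /Qmap !mxE !dE //= !addr0 w0 !mul0r.
rewrite (@altsumID _ _ _ (P 2)); last first.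
  apply: (@altsum_shift0 _ _ (d 3)) => // w.
    by rewrite /P !mxE !dE // !addr0.
  case/andP => _ /P0 w0; congr phi.
  by rewrite /Qmap !mxE !dE //= !addr0 w0 !mul0r.
rewrite (@altsumID _ _ _ (P 4)); last first.
  apply: (@altsum_shift0 _ _ (d 5)) => // w.
    by rewrite /P !mxE !dE // !addr0.
  case/andP => _ /P0 w0; congr phi.
  by rewrite /Qmap !mxE !dE //= !addr0 w0 !mul0r.
apply: (@altsum_shift0 _ _ (d 1%N + d 3 + d 5)) => [|w|w].
- by rewrite !parityD !parity_d; apply/val_inj.
- by rewrite /P !mxE !dE // !addr0.
case/andP=> /andP[/eqP w0 /eqP w2] /eqP w4; congr phi.
(* With [w_0 = w_2 = w_4 = 1] the three flips add [e1 + e2 + (e1 + e2) = 0]. *)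
rewrite /Qmap !mxE !dE //= !(addr0, add0r) w0 w2 w4 !mul1r.
by rewrite scaler3D !scale1r F2mx_addrr addr0.
Qed.

Theorem proposition4p5 (G : topologicalZmodType) (F : nat -> set G)
    (hF : compact_filtered_group F) (hs : filtration_step 5 F) :
  ~ exists f : X51 -> G,
      injective f /\ nilspace_morphism X51_cubes (group_cubes F) f.
Proof.
case=> f [injf morf].
have := altsum_Qmap (fun x => f (x, 0)).
(* Both alternating sums vanish, this one because [F 6] is trivial, so they can be equated. *)
rewrite -(altsum_group_cube (hs 6 isT) (morf 6 _ delta_cubeP)) /altsum.
have parity0 : parity (0 : vertex 6) = 0 by rewrite /parity big1 // => i _; rewrite mxE.
rewrite (bigD1 0) //= [RHS](bigD1 0) //= parity0 !eqxx.
rewrite (eq_bigr (fun w => if parity w == 0 then f (delta_cube w) else - f (delta_cube w))).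
  (* Cancelling the common terms leaves [f (Qmap 0, 0) = f (Qmap 0, 1)], and injectivity gives
     [0 = 1] in F_2. *)
  by move/addIr/injf/(congr1 snd); rewrite /= eqxx => /eqP.
by move=> w /negPf w0; rewrite /delta_cube w0.
Qed.
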